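(* Let $S\subset\mathbb{R}^2$ be a finite point set and let $\mathbf{T}_1,\ldots,\mathbf{T}_k$ be triangulations of $S$. Let $G$ be the complete directed graph on vertex set $\{1,\ldots,k\}$ in which the arc $(i,j)$, $i\ne j$, has length $d(\mathbf{T}_i,\mathbf{T}_j)$. Then for every solution (a triangulation $C$ of $S$ together with paths $P_1,\ldots,P_k$, where $P_i$ goes from $\mathbf{T}_i$ to $C$), the objective value $\sum_{i=1}^k \mathrm{length}(P_i)$ is at least one half of the length of any cycle packing of $G$.
   Context: A parallel flip transforms a triangulation $T$ of $S$ (viewed as an edge set) into $T'=(T\setminus E)\cup E'$, where $E\subseteq T$, such that $T'$ is a triangulation of $S$ and no two edges of $E$ lie in a common triangle of $T$. A path of length $\ell$ is a sequence of triangulations $T_0,\ldots,T_\ell$ of $S$ such that each $T_{i+1}$ is obtained from $T_i$ by a parallel flip. The distance $d(T,T')$ is the minimum length of a path from $T$ to $T'$. A cycle packing of a directed graph is a collection of vertex-disjoint directed cycles (a set of arcs in which every vertex has at most one outgoing and at most one incoming arc; cycles with two arcs are allowed). The length of a cycle packing is the sum of the lengths of its arcs. *)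

(* Defs.v *)
From HB Require Import structures.
From mathcomp Require Import all_boot all_order all_algebra.
From mathcomp Require Import finmap.
From mathcomp Require Import reals.

Set Implicit Arguments.
Unset Strict Implicit.
Unset Printing Implicit Defensive.

Import Order.TTheory GRing.Theory Num.Theory.
Local Open Scope ring_scope.


Section Defs.
Variable R : realType.

Definition point := (R * R)%type.
(* An (undirected) edge is represented by the 2-element set of its endpoints;
   a geometric graph / triangulation is a finite set of such edges. *)
Definition edge := {fset point}.
Definition egraph := {fset edge}.

Definition on_seg (p q x : point) : Prop :=
  exists t : R, 0 <= t <= 1 /\
    x = ((fst p) + t * ((fst q) - (fst p)), (snd p) + t * ((snd q) - (snd p))).

Definition in_triangle (p q r x : point) : Prop :=
  exists a b c : R, [/\ 0 <= a, 0 <= b, 0 <= c, a + b + c = 1 &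
    x = (a * (fst p) + b * (fst q) + c * (fst r), a * (snd p) + b * (snd q) + c * (snd r))].

Definition is_edge (S : seq point) (e : edge) : Prop :=
  exists p q : point, [/\ p \in S, q \in S, p != q, e = [fset p; q]%fset &
    forall r, r \in S -> on_seg p q r -> r = p \/ r = q].

Definition non_crossing (e f : edge) : Prop :=
  forall p q r s x : point, e = [fset p; q]%fset -> f = [fset r; s]%fset ->
    on_seg p q x -> on_seg r s x -> x \in e /\ x \in f.

Definition plane_graph (S : seq point) (T : egraph) : Prop :=
  (forall e, e \in T -> is_edge S e) /\
  (forall e f, e \in T -> f \in T -> e != f -> non_crossing e f).

Definition triangulation (S : seq point) (T : egraph) : Prop :=
  plane_graph S T /\
  (forall T' : egraph, plane_graph S T' -> (T `<=` T')%fset -> T' = T).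

(* pqr is a triangle (bounded face) of T *)
Definition triangle_of (S : seq point) (T : egraph) (p q r : point) : Prop :=
  [/\ ((fst q) - (fst p)) * ((snd r) - (snd p)) - ((snd q) - (snd p)) * ((fst r) - (fst p)) != 0,
      [fset p; q]%fset \in T, [fset q; r]%fset \in T, [fset r; p]%fset \in T &
      forall s, s \in S -> in_triangle p q r s -> [\/ s = p, s = q | s = r]].

Definition common_triangle (S : seq point) (T : egraph) (e f : edge) : Prop :=
  exists p q r : point, triangle_of S T p q r /\
    (e \in [:: [fset p; q]%fset; [fset q; r]%fset; [fset r; p]%fset]) /\
    (f \in [:: [fset p; q]%fset; [fset q; r]%fset; [fset r; p]%fset]).

Definition parallel_flip (S : seq point) (T T' : egraph) : Prop :=
  exists E E' : egraph,
    [/\ (E `<=` T)%fset,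
        (forall e f, e \in E -> f \in E -> e != f -> ~ common_triangle S T e f),
        T' = ((T `\` E) `|` E')%fset &
        triangulation S T'].

Definition flip_path (S : seq point) (T T' : egraph) (l : nat) : Prop :=
  exists P : nat -> egraph,
    [/\ P 0%N = T, P l = T', triangulation S T &
        forall i, (i < l)%N -> parallel_flip S (P i) (P i.+1)].

Definition is_dist (S : seq point) (T T' : egraph) (d : nat) : Prop :=
  flip_path S T T' d /\ forall l, flip_path S T T' l -> (d <= l)%N.

End Defs.

(* A cycle packing of the complete digraph on 'I_k: a set of arcs (no loops)
   forming vertex-disjoint directed cycles, i.e. every vertex has at most one
   outgoing arc and exactly as many incoming as outgoing arcs. *)
Definition cycle_packing (k : nat) (A : {set 'I_k * 'I_k}) : Prop :=
  (forall a, a \in A -> (fst a) != (snd a)) /\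
  (forall v : 'I_k,
     #|[set a in A | (fst a) == v]| = #|[set a in A | (snd a) == v]| /\
     (#|[set a in A | (fst a) == v]| <= 1)%N).

(* Main.v *)
Require Import Defs.
From HB Require Import structures.
From mathcomp Require Import all_boot all_order all_algebra.
From mathcomp Require Import finmap.
From mathcomp Require Import reals.
From mathcomp Require Import boolp ring lra.

(* Two paths [T i -> C] and [T j -> C] give a path [T i -> T j] as soon as parallel
   flips can be reversed, so [d i j <= len i + len j]; summing over a packing, in
   which each vertex is the tail of at most one arc and the head of at most one
   arc, counts each [len i] at most twice.

   Reversibility: every edge [uv] of a triangulation with a point of [S] on a given
   side bounds an empty triangle on that side.  A new edge [pq] crosses a removed
   edge [uv]; the other sides of the two triangles at [uv] survive and trap [pq], so
   [p] and [q] are their apexes, and [pqu], [pqv] are the triangles at [pq] after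
   the flip.  All their sides but [pq] are old, so no two new edges share a
   triangle. *)

Section Geometry.
Import Order.TTheory GRing.Theory Num.Theory.
Local Open Scope ring_scope.
Set Implicit Arguments.
Unset Strict Implicit.
Unset Printing Implicit Defensive.
Variable R : realType.
Local Notation pt := (point R).
Implicit Types (p q r s u v w x y z a b c l : pt) (t : R).

(** * Segments, orientation and affine coordinates *)

Definition lerp p q t : pt :=
  (p.1 + t * (q.1 - p.1), p.2 + t * (q.2 - p.2)).

Definition orient p q r : R :=
  (q.1 - p.1) * (r.2 - p.2) - (q.2 - p.2) * (r.1 - p.1).

(* Affine coordinates of [x] in the frame of origin [c] and basis
   [l - c], [r - c]; meaningful only when [orient c l r != 0]. *)
Definition coordl c l r x := orient c x r / orient c l r.
Definition coordr c l r x := orient c l x / orient c l r.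

Definition strictly_between p q x := exists t, 0 < t < 1 /\ x = lerp p q t.

Lemma orient_lerp a b x y t :
  orient a b (lerp x y t) = orient a b x + t * (orient a b y - orient a b x).
Proof. rewrite /orient /=; ring. Qed.

Lemma orient_rot a b c : orient a b c = orient b c a.
Proof. rewrite /orient; ring. Qed.

Lemma orientC a b c : orient a b c = - orient b a c.
Proof. rewrite /orient; ring. Qed.

Lemma orient_id a b : orient a b b = 0.
Proof. rewrite /orient; ring. Qed.

Lemma orient_idl a b : orient a b a = 0.
Proof. rewrite /orient; ring. Qed.

Lemma coordl_lerp c l r x y t :
  coordl c l r (lerp x y t) =
  coordl c l r x + t * (coordl c l r y - coordl c l r x).
Proof. rewrite /coordl -!(orient_rot r) orient_lerp; ring. Qed.

Lemma coordr_lerp c l r x y t :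
  coordr c l r (lerp x y t) =
  coordr c l r x + t * (coordr c l r y - coordr c l r x).
Proof. rewrite /coordr orient_lerp; ring. Qed.

(** Cramer's rule for [x - c] in the basis [l - c], [r - c]. *)
Lemma coordE c l r x : orient c l r != 0 ->
  x = (c.1 + coordl c l r x * (l.1 - c.1) + coordr c l r x * (r.1 - c.1),
       c.2 + coordl c l r x * (l.2 - c.2) + coordr c l r x * (r.2 - c.2)).
Proof.
rewrite /coordl /coordr /orient => D; case: x => x1 x2 /=.
by congr pair; field.
Qed.

Lemma coord_inj c l r x y : orient c l r != 0 ->
  coordl c l r x = coordl c l r y -> coordr c l r x = coordr c l r y -> x = y.
Proof. by move=> D e1 e2; rewrite (coordE x D) (coordE y D) e1 e2. Qed.

Lemma coordr_l c l r : coordr c l r l = 0.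
Proof. by rewrite /coordr orient_id mul0r. Qed.
Lemma coordr_c c l r : coordr c l r c = 0.
Proof. by rewrite /coordr orient_idl mul0r. Qed.
Lemma coordl_r c l r : coordl c l r r = 0.
Proof. by rewrite /coordl orient_id mul0r. Qed.
Lemma coordl_c c l r : coordl c l r c = 0.
Proof. by rewrite /coordl -(orient_rot r) orient_id mul0r. Qed.
Lemma coordr_r c l r : orient c l r != 0 -> coordr c l r r = 1.
Proof. exact: divff. Qed.
Lemma coordl_l c l r : orient c l r != 0 -> coordl c l r l = 1.
Proof. exact: divff. Qed.

Definition coord_vertex := (coordr_l, coordr_c, coordl_r, coordl_c).

Lemma coord_lerp_c c l r x t :
  coordl c l r (lerp c x t) = t * coordl c l r x /\
  coordr c l r (lerp c x t) = t * coordr c l r x.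
Proof. by rewrite coordl_lerp coordr_lerp !coord_vertex; split; ring. Qed.

(** The two frame coordinates are the barycentric weights of [l] and [r]; the weight of [c] is what
    remains up to 1. *)
Lemma in_triangleP c l r x : orient c l r != 0 ->
  in_triangle c l r x <->
  [/\ 0 <= coordl c l r x, 0 <= coordr c l r x
    & coordl c l r x + coordr c l r x <= 1].
Proof.
move=> D; split.
  case=> a [b] [g] [a0 b0 g0 s1 ->].
  have ea : a = 1 - b - g by rewrite -s1; ring.
  have -> : coordl c l r (a * c.1 + b * l.1 + g * r.1,
                          a * c.2 + b * l.2 + g * r.2) = b.
    by rewrite ea /coordl /orient /=; field; move: D; rewrite /orient.
  have -> : coordr c l r (a * c.1 + b * l.1 + g * r.1,
                          a * c.2 + b * l.2 + g * r.2) = g.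
    by rewrite ea /coordr /orient /=; field; move: D; rewrite /orient.
  by split=> //; lra.
case=> h1 h2 h3.
exists (1 - coordl c l r x - coordr c l r x), (coordl c l r x), (coordr c l r x).
split=> //; [lra | lra |].
rewrite {1}(coordE x D); congr pair; ring.
Qed.

Lemma on_seg_coordl c l r x : orient c l r != 0 -> coordr c l r x = 0 ->
  0 <= coordl c l r x <= 1 -> on_seg c l x.
Proof.
move=> D e h; exists (coordl c l r x); split=> //.
by rewrite {1}(coordE x D) e; congr pair; ring.
Qed.

Lemma on_seg_coordr c l r x : orient c l r != 0 -> coordl c l r x = 0 ->
  0 <= coordr c l r x <= 1 -> on_seg c r x.
Proof.
move=> D e h; exists (coordr c l r x); split=> //.
by rewrite {1}(coordE x D) e; congr pair; ring.
Qed.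

Lemma on_seg_sym p q x : on_seg p q x -> on_seg q p x.
Proof.
case=> t [h ->]; exists (1 - t); split; first lra.
by congr pair; ring.
Qed.

Lemma strictly_between_sym p q x : strictly_between p q x -> strictly_between q p x.
Proof.
case=> t [h ->]; exists (1 - t); split; first lra.
by congr pair; ring.
Qed.

Lemma strictly_between_on_seg p q x : strictly_between p q x -> on_seg p q x.
Proof. by case=> t [h ->]; exists t; split=> //; lra. Qed.

Lemma on_seg_l p q : on_seg p q p.
Proof. exists 0; split; first lra. by case: p => ? ?; congr pair; rewrite /=; ring. Qed.

Lemma lerp0 p q : lerp p q 0 = p.
Proof. by case: p => ? ?; rewrite /lerp !mul0r !addr0. Qed.

Lemma lerp1 p q : lerp p q 1 = q.
Proof. by case: q => ? ?; congr pair; rewrite /=; ring. Qed.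

Lemma on_segP p q x : on_seg p q x -> [\/ x = p, x = q | strictly_between p q x].
Proof.
case=> t [h e].
have [t0|t0] := eqVneq t 0; first by constructor 1; rewrite e t0; exact: lerp0.
have [t1|t1] := eqVneq t 1; first by constructor 2; rewrite e t1; exact: lerp1.
by constructor 3; exists t; split=> //; rewrite !lt_neqAle eq_sym t0 t1 /=.
Qed.

Lemma orient_eq0_lerp p q x : p != q -> orient p q x = 0 ->
  exists t, x = lerp p q t.
Proof.
case: p q x => p1 p2 [q1 q2] [x1 x2] /=; rewrite /orient /= => ne e.
(* On a vertical line the parameter has to be read off the second coordinate. *)
have [d1|d1] := eqVneq (q1 - p1) 0.
  have d2 : q2 - p2 != 0.
    apply: contraNneq ne => d2.
    by apply/eqP; congr pair; apply/eqP; rewrite eq_sym -subr_eq0 ?d1 ?d2.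
  have {}e : x1 - p1 = 0.
    move/eqP: e; rewrite d1 mul0r sub0r oppr_eq0 mulf_eq0 (negPf d2) /=.
    by move/eqP.
  exists ((x2 - p2) / (q2 - p2)); rewrite /lerp /=; congr pair.
    by rewrite d1 mulr0 addr0 -[x1](subrK p1) e add0r.
  by rewrite divfK //; ring.
exists ((x1 - p1) / (q1 - p1)); rewrite /lerp /=; congr pair.
  by rewrite divfK //; ring.
have -> : x2 = p2 + (q1 - p1) * (x2 - p2) / (q1 - p1) by field.
have -> : (q1 - p1) * (x2 - p2) = (q2 - p2) * (x1 - p1) by lra.
by ring.
Qed.

Lemma lerp_inj p q t1 t2 : p != q -> lerp p q t1 = lerp p q t2 -> t1 = t2.
Proof.
move=> ne [e1 e2]; apply/eqP; rewrite -subr_eq0; apply: contraNT ne => nt.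
have h (i j : R) : i + t1 * (j - i) = i + t2 * (j - i) -> i = j.
  move=> e; have /eqP : (t1 - t2) * (j - i) = 0 by lra.
  by rewrite mulf_eq0 (negPf nt) subr_eq0 => /eqP.
by move: e1 e2 => /h e1 /h e2; case: p q e1 e2 {nt} => ? ? [? ?] /= -> ->.
Qed.

Lemma lerp_lerp p q t1 t2 t :
  lerp (lerp p q t1) (lerp p q t2) t = lerp p q (t1 + t * (t2 - t1)).
Proof. by rewrite /lerp /=; congr pair; ring. Qed.

(* Follow the segment from [z] towards the endpoint lying below the level of
   [z]: it either stays in the wedge, or leaves it through one of the sides. *)
Lemma segment_trapped c l r p q z : orient c l r != 0 ->
  0 < coordl c l r z -> 0 < coordr c l r z ->
  coordl c l r z + coordr c l r z <= 1 -> on_seg p q z ->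
  (forall x, on_seg p q x -> on_seg c l x \/ on_seg c r x -> x = p \/ x = q) ->
  exists w, [/\ w = p \/ w = q, 0 <= coordl c l r w, 0 <= coordr c l r w &
    coordl c l r w + coordr c l r w <= coordl c l r z + coordr c l r z].
Proof.
(* The level [coordl + coordr] is affine along the segment, so some endpoint is no higher than [z];
   call it [q]. *)
move=> D; wlog: p q / coordl c l r q + coordr c l r q <=
                      coordl c l r z + coordr c l r z.
  move=> W z1 z2 zk zpq ex.
  have [hq|hq] := lerP (coordl c l r q + coordr c l r q)
                       (coordl c l r z + coordr c l r z); first exact: W.
  have [||w [hw ? ? ?]] := W q p _ z1 z2 zk (on_seg_sym zpq).
  - case: zpq hq => t [t01 ->]; rewrite -/(lerp p q t) coordl_lerp coordr_lerp.
    move=> hq; have [le_pq|lt_qp] := lerP (coordl c l r p + coordr c l r p)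
                                       (coordl c l r q + coordr c l r q); nra.
  - by move=> x /on_seg_sym h1 /(ex x h1) [] ->; [right | left].
  - by exists w; split=> //; case: hw => ->; [right | left].
move=> hq z1 z2 zk [t [t01 ez]] ex.
have seg k : 0 <= k <= 1 -> on_seg p q (lerp z q k).
  move=> k01; exists (t + k * (1 - t)); split; first by nra.
  by rewrite ez -/(lerp p q t) -{2}(lerp1 p q) lerp_lerp.
have low k : 0 <= k -> coordl c l r (lerp z q k) + coordr c l r (lerp z q k)
                       <= coordl c l r z + coordr c l r z.
  move=> k0; rewrite coordl_lerp coordr_lerp -subr_ge0.
  set d := (X in 0 <= X).
  have -> : d = k * (coordl c l r z + coordr c l r z -
                     (coordl c l r q + coordr c l r q)) by rewrite /d; ring.
  by rewrite mulr_ge0 ?subr_ge0.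
(* The parameter at which the way from [z] to [q] meets the line [cl]. *)
set m := coordr c l r z / (coordr c l r z - coordr c l r q).
have exit_l : coordr c l r q < 0 -> 0 <= coordl c l r (lerp z q m) ->
    exists w, [/\ w = p \/ w = q, 0 <= coordl c l r w, 0 <= coordr c l r w &
      coordl c l r w + coordr c l r w <= coordl c l r z + coordr c l r z].
  move=> h2 f2.
  have mE : m * (coordr c l r z - coordr c l r q) = coordr c l r z.
    by rewrite /m divfK //; apply: lt0r_neq0; lra.
  have m01 : 0 <= m <= 1.
    apply/andP; split; first by apply: divr_ge0; lra.
    by rewrite ler_pdivrMr; lra.
  have f1 : coordr c l r (lerp z q m) = 0 by rewrite coordr_lerp; lra.
  have f3 : coordl c l r (lerp z q m) + coordr c l r (lerp z q m)
            <= coordl c l r z + coordr c l r z.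
    by apply: low; case/andP: m01.
  exists (lerp z q m); split=> //; last by rewrite f1.
  apply: ex; first exact: seg.
  by left; apply: (on_seg_coordl D f1); lra.
have [h1|h1] := lerP 0 (coordl c l r q).
  have [h2|h2] := lerP 0 (coordr c l r q); first by exists q; split=> //; right.
  apply: exit_l => //; rewrite coordl_lerp.
  have m01 : 0 <= m <= 1.
    apply/andP; split; first by apply: divr_ge0; lra.
    by rewrite ler_pdivrMr; lra.
  nra.
(* The parameter at which the way from [z] to [q] meets the line [cr]. *)
set k := coordl c l r z / (coordl c l r z - coordl c l r q).
have kE : k * (coordl c l r z - coordl c l r q) = coordl c l r z.
  by rewrite /k divfK //; apply: lt0r_neq0; lra.
have k01 : 0 <= k <= 1.
  apply/andP; split; first by apply: divr_ge0; lra.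
  by rewrite ler_pdivrMr; lra.
have e1 : coordl c l r (lerp z q k) = 0 by rewrite coordl_lerp; lra.
have e3 : coordl c l r (lerp z q k) + coordr c l r (lerp z q k)
          <= coordl c l r z + coordr c l r z.
  by apply: low; case/andP: k01.
have [h2|h2] := lerP 0 (coordr c l r (lerp z q k)).
  exists (lerp z q k); split=> //; last by rewrite e1.
  apply: ex; first exact: seg.
  by right; apply: (on_seg_coordr D e1); lra.
have g0 : coordr c l r q < 0.
  by move: h2; rewrite coordr_lerp => ?; rewrite ltNge; apply/negP=> ?; nra.
have mE : m * (coordr c l r z - coordr c l r q) = coordr c l r z.
  by rewrite /m divfK //; apply: lt0r_neq0; lra.
apply: exit_l => //.
(* [coordr] is already negative at [k], so the line [cl] is met first, while [coordl] is still
   nonnegative. *)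
have mk : m <= k.
  move: h2; rewrite coordr_lerp => h2; rewrite leNgt; apply/negP => hmk; nra.
by rewrite coordl_lerp; nra.
Qed.

(** [orient a b] is an affine function, hence determined by its values at [c], [l], [r] and the
    barycentric weights. *)
Lemma orient_coord c l r a b x : orient c l r != 0 ->
  orient a b x = (1 - coordl c l r x - coordr c l r x) * orient a b c
    + coordl c l r x * orient a b l + coordr c l r x * orient a b r.
Proof.
move=> D; rewrite {1}(coordE x D).
set A := coordl _ _ _ _; set B := coordr _ _ _ _; rewrite /orient /=; ring.
Qed.

Lemma strictly_between_neq p q x : p != q -> strictly_between p q x -> x != p /\ x != q.
Proof.
move=> ne [t [t01 ->]]; split; apply/eqP.
  by rewrite -{2}(lerp0 p q) => /(lerp_inj ne) ?; lra.
by rewrite -{2}(lerp1 p q) => /(lerp_inj ne) ?; lra.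
Qed.

Lemma fset2_eq p q r s : [fset p; q]%fset = [fset r; s]%fset ->
  (p = r /\ q = s) \/ (p = s /\ q = r).
Proof.
move=> e.
have hp : p \in [fset r; s]%fset by rewrite -e !inE eqxx.
have hq : q \in [fset r; s]%fset by rewrite -e !inE eqxx orbT.
have hr : r \in [fset p; q]%fset by rewrite e !inE eqxx.
have hs : s \in [fset p; q]%fset by rewrite e !inE eqxx orbT.
move: hp hq hr hs; rewrite !inE.
by do 4![case/orP=> /eqP ?]; subst; auto.
Qed.

Lemma fset2C p q : [fset p; q]%fset = [fset q; p]%fset :> edge R.
Proof. by apply/fsetP => x; rewrite !inE orbC. Qed.

Lemma seq_argmin (A : eqType) (f : A -> R) (P : pred A) (s : seq A) (x0 : A) :
  x0 \in s -> P x0 ->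
  exists x : A, [/\ x \in s, P x & forall y : A, y \in s -> P y -> f x <= f y].
Proof.
elim: s x0 => // h s IH x0; rewrite in_cons => x0s Px0.
have [/hasP [y ys Py]|/hasPn none] := boolP (has P s).
  have [x [xs Px xmin]] := IH y ys Py.
  have [Ph|nPh] := boolP (P h); last first.
    exists x; split=> //; first by rewrite in_cons xs orbT.
    by move=> z; rewrite in_cons => /orP [/eqP -> |]; [rewrite (negPf nPh) | exact: xmin].
  have [fle|flt] := lerP (f x) (f h).
    exists x; split=> //; first by rewrite in_cons xs orbT.
    by move=> z; rewrite in_cons => /orP [/eqP -> //|]; exact: xmin.
  exists h; split=> //; first exact: mem_head.
  move=> z; rewrite in_cons => /orP [/eqP -> //| zs Pz].
  exact: le_trans (ltW flt) (xmin z zs Pz).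
case/orP: x0s => [/eqP e|/none]; last by rewrite Px0.
subst; exists h; split=> //; first exact: mem_head.
by move=> z; rewrite in_cons => /orP [/eqP -> //|/none /negPf ->].
Qed.

(** * Edges spanned by the point set, and visibility *)

Variable S : seq pt.

Definition empty_between u s := forall x, x \in S -> ~ strictly_between u s x.

Lemma edgeP p q : is_edge S [fset p; q]%fset ->
  [/\ p \in S, q \in S, p != q & empty_between p q].
Proof.
case=> p' [q'] [p'S q'S ne e emp].
have [[? ?]|[? ?]] := fset2_eq e; subst.
  split=> // x xS xb; have [xp xq] := strictly_between_neq ne xb.
  by case: (emp x xS (strictly_between_on_seg xb)) => ex; rewrite ex eqxx in xp xq.
rewrite eq_sym ne; split=> // x xS xb.
have [xp xq] := strictly_between_neq ne (strictly_between_sym xb).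
case: (emp x xS (strictly_between_on_seg (strictly_between_sym xb))) => ex.
  by rewrite ex eqxx in xp.
by rewrite ex eqxx in xq.
Qed.

Lemma edge_vertex p q x : is_edge S [fset p; q]%fset -> x \in S ->
  on_seg p q x -> x = p \/ x = q.
Proof.
move=> /edgeP [_ _ _ emp] xS /on_segP [] //; [by left | by right |].
by move/(emp x xS).
Qed.

(** Since [z] is on both segments, one endpoint of [pq] on the line [us] puts the other there too.
    Neither endpoint is strictly between [u] and [s], so [pq] covers [us]; as an edge, [pq] then
    meets [S] only in its endpoints, which must be [u] and [s]. *)
Lemma collinear_edge u s p q x z : u \in S -> s \in S -> u != s ->
  empty_between u s -> is_edge S [fset p; q]%fset ->
  strictly_between u s z -> on_seg p q z ->
  x = p \/ x = q -> orient u s x = 0 -> [fset p; q]%fset = [fset u; s]%fset.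
Proof.
move=> uS sS us emp pqE zus; wlog: p q pqE / x = p.
  move=> W zpq [] ex ox; first by apply: W => //; left.
  by rewrite fset2C; apply: W => //; [rewrite fset2C | exact: on_seg_sym | left].
move=> ex zpq _; rewrite {}ex => op.
have [pS qS pq _] := edgeP pqE.
have [t et] := orient_eq0_lerp us op.
case: (zus) => tz [tz01 ez].
case: (zpq) => k [k01 ekz].
have k0 : k != 0.
  apply/eqP => k0; apply: (emp p pS); suff <- : z = p by [].
  by rewrite ekz k0; exact: lerp0.
have oq : orient u s q = 0.
  have := orient_lerp u s p q k; rewrite op {1}/lerp -ekz ez orient_lerp orient_id orient_idl.
  move=> e; have /eqP : k * orient u s q = 0 by lra.
  by rewrite mulf_eq0 (negPf k0) => /eqP.
have [t' et'] := orient_eq0_lerp us oq.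
have tk : tz = t + k * (t' - t).
  by apply: (lerp_inj us); rewrite -lerp_lerp -et -et' -ez ekz.
have out tt : lerp u s tt \in S -> tt <= 0 \/ 1 <= tt.
  move=> inS; have [?|h0] := lerP tt 0; first by left.
  have [?|h1] := lerP 1 tt; first by right.
  by case: (emp _ inS); exists tt; rewrite h0 h1.
have seg tt : t <= tt <= t' \/ t' <= tt <= t -> on_seg p q (lerp u s tt).
  move=> h; have [e|ne] := eqVneq t t'.
    have -> : tt = t by case: h => /andP []; lra.
    by rewrite -et; exact: on_seg_l.
  exists ((tt - t) / (t' - t)).
  have d0 : t' - t != 0 by rewrite subr_eq0 eq_sym.
  split.
    case: h => /andP [h1 h2].
      have lt : t < t' by rewrite lt_neqAle ne; lra.
      by rewrite divr_ge0 ?ler_pdivrMr ?subr_gt0 //; lra.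
    have lt : t' < t by rewrite lt_neqAle eq_sym ne; lra.
    rewrite -mulrNN -invrN !opprB.
    by rewrite divr_ge0 ?ler_pdivrMr ?subr_gt0 //; lra.
  rewrite -/(lerp p q _) et et' lerp_lerp; congr lerp.
  by rewrite divfK //; ring.
(* The parameter [tz] of [z] lies in the open unit interval and between [t] and [t'], so [t] and
   [t'] cannot lie on the same side of it. *)
have pq_range : (t <= 0 /\ 1 <= t') \/ (t' <= 0 /\ 1 <= t).
  have [] := out t; first by rewrite -et.
    have [] := out t'; first by rewrite -et'.
      by move=> *; nra.
    by left.
  have [] := out t'; first by rewrite -et'.
    by right.
  by move=> *; nra.
have up : u = p \/ u = q.
  apply: edge_vertex pqE uS _; rewrite -(lerp0 u s); apply: seg.
  by case: pq_range => -[? ?]; [left | right]; lra.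
have sp : s = p \/ s = q.
  apply: edge_vertex pqE sS _; rewrite -(lerp1 u s); apply: seg.
  by case: pq_range => -[? ?]; [left | right]; lra.
by case: up sp us => -> [] ->; rewrite ?eqxx // => _; exact: fset2C.
Qed.

Lemma non_crossing_sym (e f : edge R) : non_crossing e f -> non_crossing f e.
Proof. by move=> h p q r s x hf he h1 h2; case: (h r s p q x he hf h2 h1). Qed.

Lemma nearest_on_ray u w : w \in S -> u != w ->
  exists w' t, [/\ w' \in S, 0 < t <= 1, w' = lerp u w t & empty_between u w'].
Proof.
move=> wS uw.
(* [y - u] is [w - u] turned by a right angle, so [orient u y x] is the scalar product of [w - u]
   and [x - u]; minimising it on the ray finds the nearest point. *)
pose y : pt := (u.1 + (w.2 - u.2), u.2 - (w.1 - u.1)).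
have yw : 0 < orient u y w.
  have -> : orient u y w = (w.1 - u.1) ^+ 2 + (w.2 - u.2) ^+ 2.
    by rewrite /orient /y /=; ring.
  rewrite lt_neqAle addr_ge0 ?sqr_ge0 // andbT eq_sym paddr_eq0 ?sqr_ge0 //.
  rewrite !sqrf_eq0 !subr_eq0; apply: contra uw => /andP [/eqP e1 /eqP e2].
  by case: (u) (w) e1 e2 => ? ? [? ?] /= -> ->.
pose P x := (orient u w x == 0) && (0 < orient u y x <= orient u y w).
have [|x [xS /andP [/eqP xl /andP[x0 x1]] xmin]] := seq_argmin (orient u y) (P := P) wS.
  by rewrite /P orient_id eqxx yw lexx.
have [t et] := orient_eq0_lerp uw xl.
have oyl k : orient u y (lerp u w k) = k * orient u y w.
  by rewrite orient_lerp orient_idl; ring.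
have tE : orient u y x = t * orient u y w by rewrite et oyl.
exists x, t; split=> //.
  apply/andP; split; first by rewrite -(pmulr_lgt0 _ yw) -tE.
  by rewrite -(ler_pM2r yw) mul1r -tE.
move=> x' x'S [k [/andP [k0 k1] ex']].
have ex : orient u y x' = k * orient u y x.
  by rewrite ex' orient_lerp orient_idl; ring.
have : orient u y x <= orient u y x'.
  apply: xmin => //; rewrite /P ex mulr_gt0 //= ex' orient_lerp orient_idl xl.
  by apply/andP; split; [apply/eqP; ring | nra].
by rewrite ex => ?; nra.
Qed.

(** * Triangles on either side of an edge of a triangulation *)

Section Triangulation.
Variable T : egraph R.
Hypothesis HT : triangulation S T.

Lemma triangulation_edge e : e \in T -> is_edge S e.
Proof. by case: HT => -[h _] _; exact: h. Qed.

Lemma triangulation_meet p q r s x :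
  [fset p; q]%fset \in T -> [fset r; s]%fset \in T ->
  [fset p; q]%fset != [fset r; s]%fset :> edge R ->
  on_seg p q x -> on_seg r s x -> (x = p \/ x = q) /\ (x = r \/ x = s).
Proof.
case: HT => -[_ h] _ h1 h2 ne x1 x2.
have [] := h _ _ h1 h2 ne p q r s x erefl erefl x1 x2; rewrite !inE.
by move=> /orP [] /eqP -> /orP [] /eqP ->; auto.
Qed.

(** Maximality: if no edge met the open segment [us], adding [us] to [T] would keep the graph
    plane. *)
Lemma missing_edge_crossed u s : u \in S -> s \in S -> u != s ->
  empty_between u s -> [fset u; s]%fset \notin T ->
  exists p q z, [/\ [fset p; q]%fset \in T, strictly_between u s z & on_seg p q z].
Proof.
move=> uS sS us emp; apply: contraNP => free.
case: HT => -[edgT ncT] maxT.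
have nc (f : edge R) : f \in T -> non_crossing [fset u; s]%fset f.
  move=> fT p q p' q' x epq ef xpq xf; subst f.
  have xus : on_seg u s x.
    by case: (fset2_eq epq) => -[-> ->] //; exact: on_seg_sym.
  have xv : x = u \/ x = s.
    case/on_segP: xus; [by left | by right | move=> xb].
    by case: free; exists p', q', x.
  have xS : x \in S by case: xv => ->.
  have xf' := edge_vertex (edgT _ fT) xS xf.
  by rewrite !inE; split; [case: xv | case: xf'] => ->; rewrite eqxx ?orbT.
rewrite -(maxT ([fset u; s]%fset |` T)%fset); first exact: fset1U1.
  split.
    move=> e /fset1UP [-> | /edgT //].
    exists u, s; split=> // r rS /on_segP [] //; [by left | by right |].
    by move/(emp r rS).
  move=> e f /fset1UP [-> | eT] /fset1UP [-> | fT].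
  - by rewrite eqxx.
  - by move=> _; exact: nc.
  - by move=> _; apply: non_crossing_sym; exact: nc.
  - exact: ncT.
exact: fsubsetUr.
Qed.

(* If [us] is blocked by an edge [pq] at [z], then the point [w] of the triangle
   [uzp] of smallest angle with [uz] is blocked by strictly fewer edges: an edge
   blocking [uw] cannot end in the swept region nor cross [zp], so it blocks [us]. *)
Lemma neighbour_on_side_rec u v (k : R) (n : nat) : u \in S ->
  forall (B : egraph R) s, (#|` B| <= n)%N -> s \in S ->
  0 < k * orient u v s -> empty_between u s ->
  (forall p q z, [fset p; q]%fset \in T -> strictly_between u s z ->
     on_seg p q z -> [fset p; q]%fset \in B) ->
  exists w, [/\ w \in S, 0 < k * orient u v w & [fset u; w]%fset \in T].
Proof.
(* Induction on a bound for the size of [B], a set containing every edge that blocks [us]. With [B]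
   empty, nothing blocks [us], which is therefore in [T]. *)
move=> uS; elim: n => [|n IH] B s Bn sS sside emp blk;
  (have [?|usT] := boolP ([fset u; s]%fset \in T); first by exists s);
  have us : u != s by (apply: contraTneq sside => <-; rewrite orient_idl mulr0 ltxx).
  have [p [q [z [pqT zb zpq]]]] := missing_edge_crossed uS sS us emp usT.
  have := blk p q z pqT zb zpq.
  by move: Bn; rewrite leqn0 cardfs_eq0 => /eqP ->; rewrite inE.
have [p [q [z [pqT zb zpq]]]] := missing_edge_crossed uS sS us emp usT.
have [tz [tz01 ez]] := zb.
have zside : 0 < k * orient u v z.
  rewrite ez orient_lerp orient_idl.
  have -> : k * (0 + tz * (orient u v s - 0)) = tz * (k * orient u v s) by ring.
  by rewrite mulr_gt0 //; case/andP: tz01.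
(* The point [z] of [pq] is strictly on the chosen side, so [p] or [q] is. *)
wlog pside : p q pqT zpq / 0 < k * orient u v p.
  move=> W; have [hp|hp] := ltrP 0 (k * orient u v p); first exact: (W p q).
  have [hq|hq] := ltrP 0 (k * orient u v q).
    by apply: (W q p) => //; [rewrite fset2C | exact: on_seg_sym].
  have [t [t01 e]] := zpq; exfalso; move: zside; rewrite e -/(lerp p q t) orient_lerp.
  have -> : k * (orient u v p + t * (orient u v q - orient u v p)) =
    (1 - t) * (k * orient u v p) + t * (k * orient u v q) by ring.
  by move: hp hq; move: (k * _) (k * _) => A C *; nra.
have gB := blk p q z pqT zb zpq.
have pqE := triangulation_edge pqT.
have [pS qS pq pqemp] := edgeP pqE.
have zS : z \notin S by apply/negP => /emp; exact.
have D : orient u z p != 0.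
  apply/eqP => o0; case/negP: usT; rewrite -(collinear_edge uS sS us emp pqE zb zpq (x := p)) //.
    by left.
  have /eqP : tz * orient u s p = 0 by rewrite -o0 ez /orient /=; ring.
  by rewrite mulf_eq0 => /orP [/eqP ?|/eqP //]; lra.
(* In the frame at [u] with basis [z - u], [p - u], [P] selects the triangle [uzp] without its side
   [uz]. Maximising [bz / gp] minimises the angle with [uz]; [p] is a candidate. *)
pose bz := coordl u z p; pose gp := coordr u z p.
pose P x := [&& 0 <= bz x, 0 < gp x & bz x + gp x <= 1].
have [|w0 [w0S /and3P [b0 g0 bg1] w0min]] := seq_argmin (fun x => - (bz x / gp x)) (P := P) pS.
  by rewrite /P /bz /gp coordr_r // coord_vertex; apply/and3P; split; lra.
have m0 : 0 < bz w0 + gp w0 by lra.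
(* The ray from [u] through [w0] meets the segment [zp] at the point [w'] of parameter [G]; [w0] is
   [w'] scaled by [m] about [u]. *)
pose m := bz w0 + gp w0; pose G := gp w0 / m.
have Gm : m * G = gp w0 by rewrite /G mulrC divfK //; apply: lt0r_neq0.
have G01 : 0 < G <= 1.
  apply/andP; split; first exact: divr_gt0.
  by rewrite /G ler_pdivrMr // mul1r /m; lra.
pose w' := lerp z p G.
have bw' : bz w' = 1 - G.
  by rewrite /bz /w' coordl_lerp coordl_l // coord_vertex; ring.
have gw' : gp w' = G.
  by rewrite /gp /w' coordr_lerp coordr_r // coord_vertex; ring.
have w0E : w0 = lerp u w' m.
  have [h1 h2] := coord_lerp_c u z p w' m.
  apply: (coord_inj D).
    by rewrite h1 -/(bz w0) -/(bz w') bw' mulrBr mulr1 Gm /m; ring.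
  by rewrite h2 -/(gp w0) -/(gp w') gw' Gm.
have uw0 : u != w0.
  by apply: contraTneq g0 => <-; rewrite /gp coord_vertex ltxx.
(* Other points of [S] may hide [w0] from [u]; the first one on the ray makes the same angle and is
   not hidden. *)
have [w [t [wS t01 wE wemp]]] := nearest_on_ray w0S uw0.
have wE' : w = lerp u w' (t * m).
  by rewrite wE w0E -{1}(lerp0 u w') lerp_lerp; congr lerp; ring.
have wside : 0 < k * orient u v w.
  rewrite wE' /w' !orient_lerp orient_idl.
  have -> : k * (0 + t * m * (orient u v z + G * (orient u v p - orient u v z) - 0))
     = t * m * ((1 - G) * (k * orient u v z) + G * (k * orient u v p)) by ring.
  by rewrite mulr_gt0 ?mulr_gt0 //; nra.
have [?|uwT] := boolP ([fset u; w]%fset \in T); first by exists w.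
have uw : u != w by (apply: contraTneq wside => <-; rewrite orient_idl mulr0 ltxx).
(* It remains to see that an edge blocking [uw] lies in [B] and differs from [pq]. *)
apply: (IH (B `\ [fset p; q])%fset w) => //.
  by move: Bn; rewrite (cardfsD1 [fset p; q]%fset) gB.
move=> p' q' z' hT zb' zpq'; have hE := triangulation_edge hT.
have [p'S q'S _ _] := edgeP hE.
have [t' [t'01 ez']] := zb'.
pose ro := t' * (t * m).
have z'E : z' = lerp u w' ro.
  by rewrite ez' wE' -{1}(lerp0 u w') lerp_lerp; congr lerp; rewrite /ro; ring.
have ro01 : 0 < ro < 1.
  have tm : 0 < t * m <= 1 by rewrite mulr_gt0 /m //=; nra.
  by rewrite /ro; apply/andP; split; nra.
(* [pq] lies on the line [bz + gp = 1], whereas this sum is [ro < 1] at [z']. *)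
have hg : [fset p'; q']%fset != [fset p; q]%fset :> edge R.
  apply/eqP => e.
  have z'pq : on_seg p q z'.
    by case: (fset2_eq e) => -[<- <-] //; exact: on_seg_sym.
  have [tau [tau01 ezpq]] := zpq.
  have [sig [sig01 ez'pq]] := z'pq.
  have tau0 : tau != 0.
    by apply: contraNneq zS => t0; rewrite ezpq t0 -/(lerp p q _) lerp0.
  have sz : bz z + gp z = 1.
    by rewrite /bz /gp coordl_l // !coord_vertex addr0.
  have sq : bz q + gp q = 1.
    move: sz; rewrite ezpq -/(lerp p q _) /bz /gp coordl_lerp coordr_lerp.
    rewrite coordl_r coordr_r // -/(bz q) -/(gp q) => e1.
    have /eqP : tau * (bz q + gp q - 1) = 0 by lra.
    by rewrite mulf_eq0 (negPf tau0) subr_eq0 => /eqP.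
  have : bz z' + gp z' = 1.
    rewrite ez'pq -/(lerp p q _) /bz /gp coordl_lerp coordr_lerp.
    rewrite coordl_r coordr_r // -/(bz q) -/(gp q).
    have -> : bz q = 1 - gp q by lra.
    by ring.
  have [h1 h2] := coord_lerp_c u z p w' ro.
  rewrite z'E /bz /gp h1 h2 -/(bz w') -/(gp w') bw' gw'; lra.
(* Outside [B], the edge [p'q'] misses the open segment [us], and it can meet [pq] only at an
   endpoint. The sides [zu] and [zw'] thus trap an endpoint [e] in the triangle [z u w']. *)
rewrite in_fsetD1 hg /=; apply: contraTT isT => hB.
have D' : orient z u w' != 0.
  rewrite /w' orient_lerp orient_idl subr0 add0r mulf_neq0 //.
    by apply: lt0r_neq0; case/andP: G01.
  by rewrite orientC oppr_eq0.
have lz' : coordl z u w' z' = 1 - ro.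
  by rewrite z'E coordl_lerp coordl_l // coord_vertex; ring.
have rz' : coordr z u w' z' = ro.
  by rewrite z'E coordr_lerp coordr_r // coord_vertex; ring.
have [||||e [epq le re se]] := segment_trapped D' _ _ _ zpq'.
- by rewrite lz'; lra.
- by rewrite rz'; lra.
- by rewrite lz' rz'; lra.
- move=> x xh [xzu|[kx [kx01 ex]]].
    have [xz|xu|xb] := on_segP xzu.
    + by case/negP: hB; apply: (blk _ _ z) => //; rewrite -xz.
    + by apply: edge_vertex hE _ xh; rewrite xu.
    + case/negP: hB; apply: (blk _ _ x) => //.
      case: (strictly_between_sym xb) => kb [kb01 ->].
      exists (kb * tz); split; first by apply/andP; split; nra.
      by rewrite ez -{1}(lerp0 u s) lerp_lerp; congr lerp; ring.
  have xpq : on_seg p q x.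
    have [tau [tau01 ezpq]] := zpq.
    exists (tau * (1 - kx * G)); split.
      by have : 0 <= kx * G <= 1 by [nra]; move=> *; apply/andP; split; nra.
    by rewrite ex /w' ezpq /lerp /=; congr pair; ring.
  by case: (triangulation_meet hT pqT hg xh xpq).
have eS : e \in S by case: epq => ->.
(* With [e] on the line [uw], the edge [p'q'] would be [uw], which is not in [T]. *)
suff oe : orient u w e = 0.
  case/negP: uwT.
  by rewrite -(collinear_edge uS wS uw wemp hE zb' zpq' epq oe).
have oc := orient_coord _ _ e D'.
rewrite lz' rz' in se.
move: le re se oc; set A := coordl z u w' e; set C := coordr z u w' e => le re se oc.
have bzE : bz e = (1 - A - C) + C * (1 - G).
  rewrite /bz /coordl -(orient_rot p) (oc p u) !(orient_rot p).
  rewrite mulrDl mulrDl -!mulrA -!/(coordl u z p _) -/(bz w') bw'.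
  by rewrite coordl_l // coord_vertex; ring.
have gpE : gp e = C * G.
  rewrite /gp /coordr (oc u z).
  rewrite mulrDl mulrDl -!mulrA -!/(coordr u z p _) -/(gp w') gw'.
  by rewrite !coord_vertex; ring.
have [C0|C0] := eqVneq C 0.
  have : on_seg z u e by apply: (on_seg_coordl D' C0); rewrite -/A; lra.
  case/on_segP => [ez0|->|eb].
  - by rewrite -ez0 eS in zS.
  - exact: orient_idl.
  - case: (emp e eS); case: (strictly_between_sym eb) => kb [kb01 ->].
    exists (kb * tz); split; first by apply/andP; split; nra.
    by rewrite ez -{1}(lerp0 u s) lerp_lerp; congr lerp; ring.
have Cp : 0 < C by rewrite lt_neqAle eq_sym C0.
have gep : 0 < gp e by rewrite gpE mulr_gt0 //; case/andP: G01.
have := w0min e eS; rewrite /P gep bzE gpE => /(_ _).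
have pe : [&& 0 <= 1 - A - C + C * (1 - G), true & 1 - A - C + C * (1 - G) + C * G <= 1].
  by apply/and3P; split => //; nra.
move/(_ pe); rewrite lerN2 -gpE ler_pdivrMr // [bz w0 / _ * _]mulrAC ler_pdivlMr // gpE -Gm.
have -> : bz w0 = m * (1 - G) by rewrite mulrBr mulr1 Gm /m; ring.
move=> hle.
(* [1 - A - C] is the weight of [z] in [e]. If it were positive, [e] would make a smaller angle with
   [uz] than [w0]. *)
have AC : 1 - A - C = 0.
  apply/eqP; rewrite eq_le; apply/andP; split; last by lra.
  have mG : 0 < m * G by rewrite Gm.
  rewrite -(pmulr_lle0 _ mG); move: hle; lra.
rewrite oc AC orient_idl wE'.
have -> : orient u (lerp u w' (t * m)) w' = 0 by rewrite /orient /=; ring.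
by ring.
Qed.

(** The sign of [k] selects the side of [uv]. All of [T] serves as the initial set of possible
    blockers. *)
Lemma neighbour_on_side u v s (k : R) : u \in S -> s \in S ->
  0 < k * orient u v s ->
  exists w, [/\ w \in S, 0 < k * orient u v w & [fset u; w]%fset \in T].
Proof.
move=> uS sS sside.
have us : u != s by (apply: contraTneq sside => <-; rewrite orient_idl mulr0 ltxx).
have [s' [t [s'S /andP [t0 _] es' emp]]] := nearest_on_ray sS us.
have s'side : 0 < k * orient u v s'.
  by rewrite es' orient_lerp orient_idl subr0 add0r mulrCA mulr_gt0.
exact: (neighbour_on_side_rec uS (leqnn #|` T|) s'S s'side emp (B := T)).
Qed.

(** The apex is the neighbour [a] of [u] on the given side with the smallest angle [vua]. No edge at
    [u] enters this angle, which first makes the triangle [uva] empty and then forces [va] into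
    [T]. *)
Lemma triangle_on_side u v s (k : R) : [fset u; v]%fset \in T -> s \in S ->
  0 < k * orient u v s ->
  exists a, triangle_of S T u v a /\ 0 < k * orient u v a.
Proof.
move=> uvT sS sside.
have uvE := triangulation_edge uvT.
have [uS vS uv uvemp] := edgeP uvE.
have [a0 [a0S a0side ua0T]] := neighbour_on_side uS sS sside.
pose y : pt := (u.1 + (v.2 - u.2), u.2 - (v.1 - u.1)).
have yv : 0 < orient u y v.
  have -> : orient u y v = (v.1 - u.1) ^+ 2 + (v.2 - u.2) ^+ 2.
    by rewrite /orient /y /=; ring.
  rewrite lt_neqAle addr_ge0 ?sqr_ge0 // andbT eq_sym paddr_eq0 ?sqr_ge0 //.
  rewrite !sqrf_eq0 !subr_eq0; apply: contra uv => /andP [/eqP e1 /eqP e2].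
  by case: (u) (v) e1 e2 => ? ? [? ?] /= -> ->.
(* [orient u y x] is the scalar product of [v - u] and [x - u], so this
   minimises the angle [vua]. *)
have [|a [aS /andP [uaT aside] amin]] := seq_argmin
  (fun x => - (orient u y x / (k * orient u v x)))
  (P := fun x => ([fset u; x]%fset \in T) && (0 < k * orient u v x)) a0S.
  by rewrite ua0T.
have uaE := triangulation_edge uaT.
have [_ _ ua uaemp] := edgeP uaE.
have D : orient u v a != 0.
  by apply: contraTneq aside => ->; rewrite mulr0 ltxx.
pose L := coordl u v a; pose M := coordr u v a.
(* An edge from [u] into the open angle would beat [a]. *)
have sector w : [fset u; w]%fset \in T -> 0 < L w -> 0 < M w -> False.
  move=> uwT Lw Mw; have [_ wS _ _] := edgeP (triangulation_edge uwT).
  have ow : orient u v w = M w * orient u v a by rewrite /M /coordr divfK.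
  have dw : orient u y w = L w * orient u y v + M w * orient u y a.
    by rewrite (orient_coord _ _ w D) orient_idl -/(L w) -/(M w); ring.
  have wside : 0 < k * orient u v w by rewrite ow mulrCA mulr_gt0.
  have := amin w wS; rewrite uwT wside => /(_ isT).
  rewrite lerN2 ler_pdivrMr // mulrAC ler_pdivlMr // ow dw => hle.
  have : L w * orient u y v * (k * orient u v a) <= 0 by move: hle; lra.
  by apply/negP; rewrite -ltNge mulr_gt0 // mulr_gt0.
(* The trapped endpoint is not [u], since the edge would then leave [u] inside the sector. *)
have trap p q z : [fset p; q]%fset \in T -> on_seg p q z ->
    0 < L z -> 0 < M z -> L z + M z <= 1 ->
    exists w, [/\ w = p \/ w = q, w \in S, w <> u, 0 <= L w & 0 <= M w /\ L w + M w <= L z + M z].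
  move=> pqT zpq Lz Mz LMz.
  have pqE := triangulation_edge pqT; have [pS qS _ _] := edgeP pqE.
  have ne_uv : [fset p; q]%fset != [fset u; v]%fset :> edge R.
    apply/eqP => e; have [tau [_ ez]] : on_seg u v z.
      by case: (fset2_eq e) => -[<- <-] //; exact: on_seg_sym.
    by move: Mz; rewrite /M ez coordr_lerp !coord_vertex subrr mulr0 addr0 ltxx.
  have ne_ua : [fset p; q]%fset != [fset u; a]%fset :> edge R.
    apply/eqP => e; have [tau [_ ez]] : on_seg u a z.
      by case: (fset2_eq e) => -[<- <-] //; exact: on_seg_sym.
    by move: Lz; rewrite /L ez coordl_lerp !coord_vertex subrr mulr0 addr0 ltxx.
  have [|w [wpq Lw Mw LMw]] := segment_trapped D Lz Mz LMz zpq.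
    move=> x xpq [xs|xs].
      by case: (triangulation_meet pqT uvT ne_uv xpq xs).
    by case: (triangulation_meet pqT uaT ne_ua xpq xs).
  exists w; split=> //; first by case: wpq => ->.
  move=> wu; subst w.
  have [q' [uq'T [tau [tau01 ez]]]] :
      exists q', [fset u; q']%fset \in T /\ on_seg u q' z.
    case: wpq => e; [exists q | exists p]; first by rewrite e.
    by rewrite e fset2C; split=> //; exact: on_seg_sym.
  have [l1 l2] := coord_lerp_c u v a q' tau.
  by apply: (sector q' uq'T); move: Lz Mz; rewrite /L /M ez l1 l2 => *; nra.
have empT x : x \in S -> in_triangle u v a x -> [\/ x = u, x = v | x = a].
  move=> xS /(in_triangleP _ D) [Lx Mx LMx].
  apply: contrapT => nx.
  (* Among the offending points take [w] of least level [L + M]. Nothing in [S] hides it from [u],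
     yet [uw] is not an edge; an edge crossing [uw] has a trapped endpoint of still smaller
     level. *)
  pose P x := [&& 0 <= L x, 0 <= M x, L x + M x <= 1 & x \notin [:: u; v; a]].
  have [|w [wS /and4P [Lw Mw LMw wn] wmin]] :=
    seq_argmin (fun x => L x + M x) (P := P) xS.
    rewrite /P Lx Mx LMx /= !inE; apply/negP => /or3P [] /eqP e; apply: nx.
    - by constructor 1.
    - by constructor 2.
    - by constructor 3.
  have Lw0 : 0 < L w.
    rewrite lt_neqAle Lw andbT eq_sym; apply: contra wn => /eqP L0.
    have wua : on_seg u a w by apply: (on_seg_coordr D L0); rewrite -/(M w); lra.
    by rewrite !inE; case: (edge_vertex uaE wS wua) => ->; rewrite eqxx ?orbT.
  have Mw0 : 0 < M w.
    rewrite lt_neqAle Mw andbT eq_sym; apply: contra wn => /eqP M0.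
    have wuv : on_seg u v w by apply: (on_seg_coordl D M0); rewrite -/(L w); lra.
    by rewrite !inE; case: (edge_vertex uvE wS wuv) => ->; rewrite eqxx ?orbT.
  have notin w1 : w1 \in S -> w1 <> u -> 0 <= L w1 -> 0 <= M w1 ->
      L w1 + M w1 < L w + M w -> False.
    move=> w1S w1u Lw1 Mw1 lt1.
    have : L w + M w <= L w1 + M w1.
      apply: wmin => //; rewrite /P Lw1 Mw1 !inE /=; apply/andP; split; first lra.
      apply/negP => /or3P [] /eqP e //; move: lt1 LMw; rewrite e /L /M.
        by rewrite coordl_l // coord_vertex => *; lra.
      by rewrite coordr_r // coord_vertex => *; lra.
    by lra.
  have uw : u != w.
    by apply: contraTneq Lw0 => <-; rewrite /L coord_vertex ltxx.
  have Lb x1 : strictly_between u w x1 ->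
      [/\ 0 < L x1, 0 < M x1 & L x1 + M x1 < L w + M w].
    case=> tau [tau01 ->]; have [l1 l2] := coord_lerp_c u v a w tau.
    by rewrite /L /M l1 l2 -/(L w) -/(M w); split; nra.
  have wemp : empty_between u w.
    move=> x1 x1S /Lb [L1 M1 LM1]; apply: (notin x1) => //; [|lra..].
    by move=> e; move: L1; rewrite e /L coord_vertex ltxx.
  have uwT : [fset u; w]%fset \notin T by apply/negP => /sector; exact.
  have [p [q [z [pqT /Lb [Lz Mz LMz] zpq]]]] := missing_edge_crossed uS wS uw wemp uwT.
  have [|w1 [_ w1S w1u Lw1 [Mw1 LMw1]]] := trap p q z pqT zpq Lz Mz; first lra.
  by apply: (notin w1) => //; lra.
have va : v != a by apply: contraNneq D => ->; rewrite orient_id.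
have vab x : strictly_between v a x -> [/\ 0 < L x, 0 < M x & L x + M x = 1].
  case=> tau [tau01 ->]; rewrite /L /M coordl_lerp coordr_lerp.
  by rewrite coordl_l // coordr_r // !coord_vertex; split; lra.
(* An edge blocking [va] has a trapped endpoint in the empty triangle, namely [v] or [a]; it is then
   collinear with [va] and equal to it. *)
have vaT : [fset v; a]%fset \in T.
  apply: contrapT => /negP vaT.
  have vaemp : empty_between v a.
    move=> x xS xb; have [L0 M0 LM] := vab x xb.
    have [xv xa] := strictly_between_neq va xb.
    have [|e|e|e] := empT x xS; first by apply/(in_triangleP _ D); split; rewrite -/(L x) -/(M x); lra.
    - by move: L0; rewrite e /L coord_vertex ltxx.
    - by rewrite e eqxx in xv.
    - by rewrite e eqxx in xa.
  have [p [q [z [pqT zb zpq]]]] := missing_edge_crossed vS aS va vaemp vaT.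
  have [L0 M0 LM] := vab z zb.
  have [|w [wpq wS wu Lw [Mw LMw]]] := trap p q z pqT zpq L0 M0; first lra.
  case/negP: vaT.
  rewrite -(collinear_edge vS aS va vaemp (triangulation_edge pqT) zb zpq wpq) //.
  have [|//|->|->] := empT w wS.
  - by apply/(in_triangleP _ D); split; rewrite -/(L w) -/(M w); lra.
  - exact: orient_idl.
  - exact: orient_id.
exists a; split=> //; split=> //; by rewrite fset2C.
Qed.

End Triangulation.

(** * Reversing a parallel flip *)

Lemma in_triangle_rot p q r x : in_triangle p q r x -> in_triangle q r p x.
Proof.
case=> a [b] [c] [a0 b0 c0 s1 ->]; exists b, c, a; split=> //; first lra.
by congr pair; ring.
Qed.

Lemma triangle_of_rot T p q r : triangle_of S T p q r -> triangle_of S T q r p.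
Proof.
case=> D h1 h2 h3 emp; split=> //; first by rewrite -/(orient q r p) -orient_rot.
move=> s sS /in_triangle_rot /in_triangle_rot /(emp s sS) [] ->.
- by constructor 3.
- by constructor 1.
- by constructor 2.
Qed.

(** Let [x] be the common point of [pq] and [uv]. The inequalities place [r] in the triangle
    [u x p], which is part of [uvp]. *)
Lemma in_triangle_cut p q u v r t (k A B : R) :
  0 < t < 1 -> 0 <= k <= 1 -> lerp p q t = lerp u v k ->
  0 <= B -> A + B <= 1 -> B * (1 - t) <= A * t ->
  r = (u.1 + A * (p.1 - u.1) + B * (q.1 - u.1),
       u.2 + A * (p.2 - u.2) + B * (q.2 - u.2)) ->
  in_triangle u v p r.
Proof.
move=> /andP [t0 t1] k01 [e1 e2] B0 AB hAB ->.
have tn : t != 0 by apply: lt0r_neq0.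
have Bt : 0 <= B / t by apply: divr_ge0; lra.
have BtE : B / t * t = B by rewrite divfK.
(* Obtained by eliminating [q] through [x = (1 - t) p + t q] and then writing
   [x = (1 - k) u + k v]. *)
exists (1 - A - B + B / t * (1 - k)), (B / t * k), (A - B / t * (1 - t)); split.
- by nra.
- by apply: mulr_ge0 => //; lra.
- rewrite subr_ge0 mulrAC ler_pdivrMr //.
- by move: BtE; lra.
have {e1}-> : q.1 = p.1 + (u.1 - p.1 + k * (v.1 - u.1)) / t.
  by apply: (mulfI tn); rewrite mulrDr mulrC [t * (_ / t)]mulrC divfK //; lra.
have {e2}-> : q.2 = p.2 + (u.2 - p.2 + k * (v.2 - u.2)) / t.
  by apply: (mulfI tn); rewrite mulrDr mulrC [t * (_ / t)]mulrC divfK //; lra.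
by congr pair; field.
Qed.

(** Case analysis on the signs of the coordinates [A], [B] of [r] in the frame at [u] with basis
    [p - u], [q - u]. If both are nonnegative, [r] lies in [uvp] or [uvq], which are empty. If only
    [B] is negative, [qr] crosses [up]; if only [A] is, [rp] crosses [uq]. If both are, [u] lies in
    the empty triangle [pqr]. *)
Lemma apex_unique T p q r u v x : triangulation S T ->
  triangle_of S T p q r -> strictly_between p q x -> strictly_between u v x ->
  (forall s, s \in S -> in_triangle u v p s -> [\/ s = u, s = v | s = p]) ->
  (forall s, s \in S -> in_triangle u v q s -> [\/ s = u, s = v | s = q]) ->
  [fset u; p]%fset \in T -> [fset u; q]%fset \in T ->
  0 < orient p q r * orient p q u -> r = u.
Proof.
move=> HT [Dr pqT qrT rpT empr] [t [t01 ex]] [k [k01 ex']] empp empq upT uqT same.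
rewrite -/(orient p q r) in Dr.
have [uS qS uq _] := edgeP (triangulation_edge HT uqT).
have [rS pS rp _] := edgeP (triangulation_edge HT rpT).
have [_ _ qr _] := edgeP (triangulation_edge HT qrT).
have [_ _ up _] := edgeP (triangulation_edge HT upT).
have [_ _ pq _] := edgeP (triangulation_edge HT pqT).
have ou : orient p q u != 0 by apply: contraTneq same => ->; rewrite mulr0 ltxx.
have D : orient u p q != 0 by rewrite orient_rot.
have rE := coordE r D; have := orient_coord p q r D.
have lA : coordl u p q p = 1 by apply: coordl_l.
have rB : coordr u p q q = 1 by apply: coordr_r.
have [A eA] : exists A, coordl u p q r = A by exists (coordl u p q r).
have [B eB] : exists B, coordr u p q r = B by exists (coordr u p q r).
rewrite eA eB in rE *; rewrite orient_idl orient_id => oE.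
(* [r] is on the same side of [pq] as [u]. *)
have C0 : A + B < 1.
  rewrite -subr_gt0; have : 0 < (1 - (A + B)) * (orient p q u) ^+ 2.
    by move: same; rewrite oE; lra.
  by rewrite pmulr_lgt0 // exprn_even_gt0.
(* [v] is on the other side of [pq], because the open segment [uv] crosses [pq] at [x]. *)
have rv : r <> v.
  move=> e; subst v; have := orient_lerp p q u r k; rewrite -ex' ex orient_lerp.
  rewrite orient_idl orient_id => e0.
  have : 0 < ((1 - k) * orient p q u + k * orient p q r) * orient p q u.
    have -> : ((1 - k) * orient p q u + k * orient p q r) * orient p q u =
      (1 - k) * orient p q u ^+ 2 + k * (orient p q r * orient p q u) by ring.
    have o2 : 0 < orient p q u ^+ 2 by rewrite exprn_even_gt0.
    by apply: addr_gt0; apply: mulr_gt0 => //; lra.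
  have -> : (1 - k) * orient p q u + k * orient p q r = 0 by lra.
  by rewrite mul0r ltxx.
have [A0|A0] := lerP 0 A; have [B0|B0] := lerP 0 B.
- have [hAB|hAB] := lerP (B * (1 - t)) (A * t).
    have : in_triangle u v p r.
      have k01' : 0 <= k <= 1 by lra.
      exact: (@in_triangle_cut p q u v r t k A B t01 k01' (etrans (esym ex) ex') B0 (ltW C0) hAB rE).
    move/(empp r rS) => [] // e.
    by rewrite e eqxx in rp.
  have : in_triangle u v q r.
    have t01' : 0 < 1 - t < 1 by lra.
    have exx : lerp q p (1 - t) = lerp u v k.
      by rewrite -ex' ex /lerp; congr pair; ring.
    have BA : B + A <= 1 by lra.
    have hBA : A * (1 - (1 - t)) <= B * (1 - t) by lra.
    have k01' : 0 <= k <= 1 by lra.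
    apply: (@in_triangle_cut q p u v r (1 - t) k B A t01' k01' exx A0 BA hBA).
    by rewrite {1}rE; congr pair; ring.
  move/(empq r rS) => [] // e.
  by rewrite e eqxx in qr.
- pose m := (1 - B)^-1.
  have mE : m * (1 - B) = 1 by rewrite /m mulVf //; apply: lt0r_neq0; lra.
  have m01 : 0 < m <= 1 by rewrite invr_gt0 invf_le1; lra.
  have zl : coordl u p q (lerp q r m) = m * A.
    by rewrite coordl_lerp coord_vertex eA; ring.
  have zr : coordr u p q (lerp q r m) = 0.
    by rewrite coordr_lerp rB eB; lra.
  have z_up : on_seg u p (lerp q r m).
    by apply: (on_seg_coordl D zr); rewrite zl; apply/andP; split; nra.
  have z_qr : on_seg q r (lerp q r m) by exists m; split=> //; lra.
  have ne : [fset q; r]%fset != [fset u; p]%fset :> edge R.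
    apply/eqP => /fset2_eq [] [] e _; last by rewrite e eqxx in pq.
    by rewrite e eqxx in uq.
  have [[e|e] _] := triangulation_meet HT qrT upT ne z_qr z_up.
    by exfalso; move: zr; rewrite e rB; lra.
  by exfalso; move: zr; rewrite e eB; lra.
- pose m := (1 - A)^-1.
  have mE : m * (1 - A) = 1 by rewrite /m mulVf //; apply: lt0r_neq0; lra.
  have m01 : 0 < m <= 1 by rewrite invr_gt0 invf_le1; lra.
  have zl : coordl u p q (lerp p r m) = 0.
    by rewrite coordl_lerp lA eA; lra.
  have zr : coordr u p q (lerp p r m) = m * B.
    by rewrite coordr_lerp coord_vertex eB; ring.
  have z_uq : on_seg u q (lerp p r m).
    by apply: (on_seg_coordr D zl); rewrite zr; apply/andP; split; nra.
  have z_rp : on_seg r p (lerp p r m).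
    by apply: on_seg_sym; exists m; split=> //; lra.
  have ne : [fset r; p]%fset != [fset u; q]%fset :> edge R.
    apply/eqP => /fset2_eq [] [] _ e; first by rewrite e eqxx in pq.
    by rewrite e eqxx in up.
  have [[e|e] _] := triangulation_meet HT rpT uqT ne z_rp z_uq.
    by exfalso; move: zl; rewrite e eA; lra.
  by exfalso; move: zl; rewrite e lA; lra.
- have : in_triangle p q r u.
    pose m := (1 - A - B)^-1.
    have mE : (1 - A - B) * m = 1 by rewrite /m mulfV //; apply: lt0r_neq0; lra.
    have m0 : 0 < m by rewrite invr_gt0; lra.
    exists (- A * m), (- B * m), m; split; [nra | nra | exact: ltW | lra |].
    have n0 : 1 - A - B != 0 by apply: lt0r_neq0; lra.
    rewrite rE /m /= [LHS]surjective_pairing.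
    by congr pair; field.
  move/(empr u uS) => [] // e.
    by rewrite e eqxx in up.
  by rewrite e eqxx in uq.
Qed.

(** A triangle loses at most one side. Phrased by [T] and [T'] alone, without the exchanged sets, so
    that it can be reversed. *)
Definition flip_compatible (T T' : egraph R) := forall a b c,
  triangle_of S T a b c -> [fset a; b]%fset \notin T' ->
  [fset b; c]%fset \in T' /\ [fset c; a]%fset \in T'.

(** Let [a] be the apex over [uv] on the side of [p]. The sides [va] and [au] survive in [T'] and
    trap [pq], so an endpoint of [pq] lies in the empty triangle [uva]. It is off the line [uv],
    hence it is [a], and [q] is on the wrong side. *)
Lemma crossed_apex T T' u v p q x (k : R) :
  triangulation S T -> triangulation S T' -> flip_compatible T T' ->
  [fset u; v]%fset \in T -> [fset u; v]%fset \notin T' ->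
  [fset p; q]%fset \in T' -> [fset p; q]%fset \notin T ->
  strictly_between u v x -> on_seg p q x ->
  0 < k * orient u v p -> k * orient u v q < 0 -> triangle_of S T u v p.
Proof.
move=> HT HT' comp uvT uvT' pqT' pqT [t [t01 ex]] xpq kp kq.
have [pS qS _ _] := edgeP (triangulation_edge HT' pqT').
have [a [tri ka]] := triangle_on_side HT uvT pS kp.
have [vaT' auT'] := comp _ _ _ tri uvT'.
have [Da _ vaT auT empa] := tri; rewrite -/(orient u v a) in Da.
have D : orient a u v != 0 by rewrite orient_rot.
have lx : coordl a u v x = 1 - t.
  by rewrite ex coordl_lerp coordl_l // coord_vertex; ring.
have rx : coordr a u v x = t.
  by rewrite ex coordr_lerp coordr_r // coord_vertex; ring.
have neq (e : edge R) : e \in T -> [fset p; q]%fset != e.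
  by apply: contraTneq => <-.
have [||||w [wpq lw rw lrw]] := segment_trapped D _ _ _ xpq.
- by rewrite lx; lra.
- by rewrite rx; lra.
- by rewrite lx rx; lra.
- move=> y ypq [yau|/on_seg_sym yva].
    by case: (triangulation_meet HT' pqT' auT' (neq _ auT) ypq yau).
  by case: (triangulation_meet HT' pqT' vaT' (neq _ vaT) ypq yva).
have wS : w \in S by case: wpq => ->.
have : in_triangle u v a w.
  by apply: in_triangle_rot; apply/(in_triangleP _ D); split=> //; rewrite lx rx in lrw; lra.
case/(empa w wS) => e; subst w.
- by case: wpq => e; move: kp kq; rewrite -e orient_idl mulr0 ltxx.
- by case: wpq => e; move: kp kq; rewrite -e orient_id mulr0 ltxx.
- by case: wpq => e; subst a => //; lra.
Qed.

Lemma flip_compatible_sym T T' : triangulation S T -> triangulation S T' ->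
  flip_compatible T T' -> flip_compatible T' T.
Proof.
move=> HT HT' comp p q r tri pqT.
have [Dr pqT' qrT' rpT' _] := tri; rewrite -/(orient p q r) in Dr.
have pqE := triangulation_edge HT' pqT'.
have [pS qS pq pqemp] := edgeP pqE.
have [u [v [x [uvT xpq xuv]]]] := missing_edge_crossed HT pS qS pq pqemp pqT.
have uvE := triangulation_edge HT uvT.
have [uS vS uv uvemp] := edgeP uvE.
have ne : [fset p; q]%fset != [fset u; v]%fset :> edge R.
  by apply: contraNneq pqT => ->.
have xpq' := strictly_between_on_seg xpq.
have [xp xq] := strictly_between_neq pq xpq.
have uvT' : [fset u; v]%fset \notin T'.
  apply/negP => uvT'.
  have [[e|e] _] := triangulation_meet HT' pqT' uvT' ne xpq' xuv.
    by rewrite e eqxx in xp.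
  by rewrite e eqxx in xq.
have xuv' : strictly_between u v x.
  by case: (on_segP xuv) => // e; case: (pqemp x _ xpq); rewrite e.
(* An endpoint of one edge on the line of the other would make the two edges equal. *)
have ouv y : y = p \/ y = q -> orient u v y != 0.
  move=> yv; apply: contra ne => /eqP oy; apply/eqP.
  exact: (collinear_edge uS vS uv uvemp pqE xuv' xpq' yv oy).
have opq y : y = u \/ y = v -> orient p q y != 0.
  move=> yv; apply: contra ne => /eqP oy; rewrite eq_sym; apply/eqP.
  exact: (collinear_edge pS qS pq pqemp uvE xpq xuv yv oy).
(* [orient c d] is affine along [ab] and vanishes at the inner point [x], so it changes sign. *)
have opposite a b c d : strictly_between a b x -> strictly_between c d x ->
    orient c d a != 0 -> orient c d a * orient c d b < 0.
  move=> [t [t01 ex]] [t' [_ ex']] oa.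
  have := orient_lerp c d a b t; rewrite -ex ex' orient_lerp orient_id orient_idl.
  move=> e; have eb : t * orient c d b = (t - 1) * orient c d a by lra.
  have t0 : 0 < t by case/andP: t01.
  rewrite -(pmulr_rlt0 _ t0) mulrCA eb.
  have -> : orient c d a * ((t - 1) * orient c d a) = (t - 1) * orient c d a ^+ 2.
    by ring.
  by rewrite nmulr_rlt0 ?exprn_even_gt0 //; lra.
have sq (o : R) : o != 0 -> 0 < o * o by move=> o0; rewrite -expr2 exprn_even_gt0.
have op := ouv p (or_introl erefl); have oq := ouv q (or_intror erefl).
have triP : triangle_of S T u v p.
  by apply: (crossed_apex HT HT' comp uvT uvT' pqT' pqT xuv' xpq' (sq _ op)); exact: opposite.
have triQ : triangle_of S T u v q.
  apply: (crossed_apex HT HT' comp uvT uvT' _ _ xuv' (on_seg_sym xpq') (sq _ oq)).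
  - by rewrite fset2C.
  - by rewrite fset2C.
  - by apply: opposite => //; exact: strictly_between_sym.
have [vpT' puT'] := comp _ _ _ triP uvT'.
have [vqT' quT'] := comp _ _ _ triQ uvT'.
have [_ _ vpT puT empP] := triP; have [_ _ vqT quT empQ] := triQ.
have ou := opq u (or_introl erefl); have ov := opq v (or_intror erefl).
have ouov : orient p q u * orient p q v < 0 by exact: opposite.
(* The apex [r] is on the side of [u] or of [v] and so equals that point, whose edges to [p] and [q]
   are old. *)
have [side|side|side] := ltrgtP 0 (orient p q r * orient p q u); last 1 first.
- by move/eqP: side; rewrite eq_sym mulf_eq0 (negPf Dr) (negPf ou).
- have -> : r = u; last by rewrite (fset2C u p).
  by apply: (apex_unique HT' tri xpq xuv' empP empQ) => //; rewrite fset2C.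
have -> : r = v; last by rewrite (fset2C q v).
apply: (apex_unique HT' tri xpq (strictly_between_sym xuv') (v := u)) => //.
- move=> s sS [a [b [c [a0 b0 c0 s1 es]]]].
  case: (empP s sS) => [|->|->|->]; [|by constructor 2|by constructor 1|by constructor 3].
  by exists b, a, c; split=> //; [lra | rewrite es; congr pair; ring].
- move=> s sS [a [b [c [a0 b0 c0 s1 es]]]].
  case: (empQ s sS) => [|->|->|->]; [|by constructor 2|by constructor 1|by constructor 3].
  by exists b, a, c; split=> //; [lra | rewrite es; congr pair; ring].
by move: side ouov (sq _ ou); nra.
Qed.

Lemma triangle_of_sides T a b c : triangle_of S T a b c ->
  [fset a; b]%fset != [fset b; c]%fset :> edge R.
Proof.
case=> D _ _ _ _; rewrite -/(orient a b c) in D.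
apply/eqP => /fset2_eq [] [e _]; move: D; rewrite e.
  by rewrite orient_rot orient_idl eqxx.
by rewrite orient_idl eqxx.
Qed.

(** Edges of [T] missing from [T'] belong to [E], and two of them in one triangle would violate
    independence. *)
Lemma parallel_flip_compatible T T' : parallel_flip S T T' -> flip_compatible T T'.
Proof.
case=> E [E'] [ET indep eT' _] a b c tri abT'.
have keep (e : edge R) : e \in T -> e \notin T' -> e \in E.
  by move=> eT; rewrite eT' !inE eT andbT negb_or negbK => /andP [].
have [_ abT bcT caT _] := tri.
have abE := keep _ abT abT'.
split; apply: contrapT => /negP nT'.
  apply: (indep _ _ abE (keep _ bcT nT') (triangle_of_sides tri)).
  by exists a, b, c; rewrite !inE !eqxx ?orbT.
apply: (indep _ _ (keep _ caT nT') abE).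
  exact: triangle_of_sides (triangle_of_rot (triangle_of_rot tri)).
by exists a, b, c; rewrite !inE !eqxx ?orbT.
Qed.

Lemma parallel_flip_sym T T' : triangulation S T -> parallel_flip S T T' ->
  parallel_flip S T' T.
Proof.
move=> HT fl.
have HT' : triangulation S T' by case: fl => E [E' []].
have comp := flip_compatible_sym HT HT' (parallel_flip_compatible fl).
(* Remove exactly the new edges; adding all of [T] restores the old ones, and re-adding the common
   edges is harmless. *)
exists (T' `\` T)%fset, T; split=> //; first exact: fsubsetDl.
  move=> e f; rewrite !inE => /andP [eT eT'] /andP [fT fT'] ef [p [q [r [tri [he hf]]]]].
  have c1 := comp _ _ _ tri; have c2 := comp _ _ _ (triangle_of_rot tri).
  have c3 := comp _ _ _ (triangle_of_rot (triangle_of_rot tri)).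
  move: he hf ef eT fT; rewrite !inE.
  by case/or3P=> /eqP -> /or3P [] /eqP ->; rewrite ?eqxx // => _ h;
    first [case: (c1 h) | case: (c2 h) | case: (c3 h)] => h1 h2;
    rewrite ?h1 ?h2.
apply/fsetP => e; rewrite !inE.
by case: (e \in T) => //=; rewrite ?orbT ?orbF ?andbT ?andNb.
Qed.

(** * Reversing and concatenating paths *)

Lemma flip_path_triangulation T (l : nat) (P : nat -> egraph R) :
  P 0%N = T -> triangulation S T ->
  (forall i, (i < l)%N -> parallel_flip S (P i) (P i.+1)) ->
  forall i, (i <= l)%N -> triangulation S (P i).
Proof.
move=> P0 HT st [_|i il]; first by rewrite P0.
by case: (st i il) => E [E' []].
Qed.

Lemma flip_path_sym T T' (l : nat) : flip_path S T T' l -> flip_path S T' T l.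
Proof.
case=> P [P0 Pl HT st].
have HP := flip_path_triangulation P0 HT st.
exists (fun i => P (l - i)%N); split; rewrite ?subn0 ?subnn //.
  by rewrite -Pl; exact: HP.
move=> i il; apply: parallel_flip_sym; first by apply: HP; exact: leq_subr.
(* Step [i] of the reversed path undoes step [l - i.+1] of the original one. *)
have := st (l - i.+1)%N; rewrite -subSn // subSS; apply; exact: leq_subr.
Qed.

Lemma flip_path_cat T1 T2 T3 (m n : nat) :
  flip_path S T1 T2 m -> flip_path S T2 T3 n -> flip_path S T1 T3 (m + n).
Proof.
case=> P [P0 Pm HT1 stP] [Q [Q0 Qn HT2 stQ]].
exists (fun i => if (i <= m)%N then P i else Q (i - m)%N); split=> //.
  (* For [n = 0] the last index is still in the range of [P], and [Q 0] is the end point. *)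
  case: n Qn {stQ} => [|n] Qn; first by rewrite addn0 leqnn Pm -Q0.
  by rewrite -[X in (_ <= X)%N]addn0 leq_add2l addKn.
move=> i imn; have [im|im|im] := ltngtP i m.
- exact: stP.
- rewrite subSn ?(ltnW im) //.
  by apply: stQ; rewrite ltn_subLR // ltnW.
rewrite im subSnn Pm -Q0; apply: stQ.
by move: imn; rewrite im -[X in (X < _)%N]addn0 ltn_add2l.
Qed.

End Geometry.

(** * Counting over a cycle packing *)

Lemma sum_injective_le (I J : finType) (A : {set I}) (g : I -> J) (F : J -> nat) :
  (forall v, #|[set a in A | g a == v]| <= 1)%N ->
  (\sum_(a in A) F (g a) <= \sum_v F v)%N.
Proof.
(* Grouped by [g], every fibre in [A] has at most one element, so each [F v] occurs at most once. *)
move=> h; rewrite (partition_big g predT) //=; apply: leq_sum => v _.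
rewrite (eq_bigr (fun=> F v)) => [|a /andP [_ /eqP -> //]].
rewrite sum_nat_const -[X in (_ <= X)%N]mul1n leq_mul2r.
apply/orP; right; apply: leq_trans (h v); apply: subset_leq_card.
by apply/subsetP => a; rewrite !inE.
Qed.

Theorem theorem2 (R : realType) (S : seq (point R)) (k : nat)
  (T : 'I_k -> egraph R)
  (HT : forall i, triangulation S (T i))
  (d : 'I_k -> 'I_k -> nat)
  (Hd : forall i j, i != j -> is_dist S (T i) (T j) (d i j))
  (C : egraph R) (HC : triangulation S C)
  (len : 'I_k -> nat)
  (HP : forall i, flip_path S (T i) C (len i))
  (A : {set 'I_k * 'I_k}) (HA : cycle_packing A) :
  (\sum_(a in A) d (fst a) (snd a) <= 2 * \sum_(i < k) len i)%N.
Proof.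
have [noloop deg] := HA.
(* The path from the tail of an arc to [C], followed by the reversed path of its head, bounds the
   distance. *)
apply: (@leq_trans (\sum_(a in A) (len a.1 + len a.2))%N).
  apply: leq_sum => a aA; have [_ dmin] := Hd _ _ (noloop a aA).
  by apply: dmin; apply: flip_path_cat (HP _) (flip_path_sym (HP _)).
(* Tails and heads are summed separately; the bound on incoming arcs comes from equality of the two
   degrees. *)
rewrite big_split /= mul2n -addnn; apply: leq_add.
  by apply: sum_injective_le => v; case: (deg v).
by apply: sum_injective_le => v; case: (deg v) => <-.
Qed.
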